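(* Let $\mathfrak P$ be a reproducing kernel Pontryagin space of $\mathbb C^p$-valued functions analytic in an open set $\Omega\subset\mathbb C$ symmetric with respect to the real line, and assume that $\mathfrak P$ is resolvent invariant, i.e. $R_\alpha\mathfrak P\subset\mathfrak P$ for every $\alpha\in\Omega$. Assume moreover that $$[F,R_\beta G]_{\mathfrak P}-[R_\alpha F,G]_{\mathfrak P}+(\alpha-\overline\beta)[R_\alpha F,R_\beta G]_{\mathfrak P}=0$$ for every $\alpha,\beta\in\Omega$ and all $F,G\in\mathfrak P$. Then there is a $\mathbb C^{p\times p}$-valued function $\mathsf N(z)$ analytic in $\Omega$ and such that the reproducing kernel of $\mathfrak P$ is $$K_{\mathsf N}(z,w)=\frac{\mathsf N(z)-\mathsf N(w)^*}{z-\overline w},\qquad z,w\in\Omega$$ (understood by continuity when $z=\overline w$).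
   Context: $R_\alpha$ is the classical backward-shift (resolvent) operator: $(R_\alpha F)(z)=\frac{F(z)-F(\alpha)}{z-\alpha}$ for $z\ne\alpha$, and $(R_\alpha F)(\alpha)=F'(\alpha)$. $[\cdot,\cdot]_{\mathfrak P}$ is the indefinite inner product of $\mathfrak P$. *)

(* Defs.v *)
From HB Require Import structures.
From mathcomp Require Import all_boot all_order all_algebra.
From mathcomp Require Import all_classical all_reals all_analysis.
From mathcomp Require Import complex.

Set Implicit Arguments.
Unset Strict Implicit.
Unset Printing Implicit Defensive.

Import Order.TTheory GRing.Theory Num.Theory.
Import numFieldNormedType.Exports.

Local Open Scope classical_set_scope.
Local Open Scope ring_scope.
Local Open Scope sesquilinear_scope.

(* Seen as a numClosedFieldType, R[i] inherits the norm topology that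
   MathComp-Analysis puts on every such field, and conjugation _^*. *)
Definition complexes (R : realType) : numClosedFieldType := R[i].

Section InnerProductSpaces.
Variables (C : numClosedFieldType) (V : lmodType C).
Implicit Types (S : set V) (ip : V -> V -> C).

(* A space is a linear subspace S of an ambient V; the values of ip outside
   of S are irrelevant. Forms are linear in the first argument. *)
Definition hermitian_form S ip : Prop :=
  (forall a, {in S & &, forall u v w,
     ip (a *: u + v) w = a * ip u w + ip v w}) /\
  {in S &, forall u v, ip u v = (ip v u)^*}.

Definition ip_norm ip (u : V) : C := sqrtC (ip u u).

Definition ip_cauchy ip (u : nat -> V) : Prop :=
  forall e : C, 0 < e -> exists n0 : nat, forall m n : nat,
    (n0 <= m)%N -> (n0 <= n)%N -> ip_norm ip (u m - u n) < e.

Definition ip_cvg_to ip (u : nat -> V) (l : V) : Prop :=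
  forall e : C, 0 < e -> exists n0 : nat, forall n : nat,
    (n0 <= n)%N -> ip_norm ip (u n - l) < e.

Definition hilbert_space S ip : Prop :=
  [/\ submod_closed (mem S),
      hermitian_form S ip,
      {in S, forall u, u != 0 -> 0 < ip u u} &
      forall u : nat -> V, (forall n, S (u n)) -> ip_cauchy ip u ->
        exists2 l, S l & ip_cvg_to ip u l].

Definition finite_dimensional S : Prop :=
  exists (n : nat) (e : 'I_n -> V),
    (forall i, S (e i)) /\
    (forall u, S u -> exists a : 'I_n -> C, u = \sum_(i < n) a i *: e i).

(* S is the direct and orthogonal sum of Sp and Sm, where (Sp, ip) and
   (Sm, -ip) are Hilbert spaces and Sm has finite dimension. *)
Definition pontryagin_space S ip : Prop :=
  [/\ submod_closed (mem S),
      hermitian_form S ip &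
      exists Sp Sm : set V,
        [/\ hilbert_space Sp ip,
            hilbert_space Sm (fun u v => - ip u v),
            finite_dimensional Sm,
            (forall u v, Sp u -> Sm v -> ip u v = 0) &
            [/\ Sp `<=` S, Sm `<=` S, Sp `&` Sm = [set 0] &
                forall u, S u -> exists v w, [/\ Sp v, Sm w & u = v + w]]]].

End InnerProductSpaces.

Section FunctionSpaces.
Variables (C : numClosedFieldType) (p : nat) (Omega : set C).

(* A function on Omega is represented by its extension by 0 to all of C, so
   that equality of functions is equality on Omega. *)
Definition on_domain (F : C -> 'cV[C]_p) : C -> 'cV[C]_p :=
  patch (fun=> 0) Omega F.

Definition conj_symmetric : Prop := forall z, Omega z -> Omega z^*.

Definition analytic_in m n (F : C -> 'M[C]_(m, n)) : Prop :=
  forall z, Omega z -> derivable F z 1.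

Definition resolvent (alpha : C) (F : C -> 'cV[C]_p) : C -> 'cV[C]_p :=
  on_domain (fun z =>
    if z == alpha then derive1 F alpha else (z - alpha)^-1 *: (F z - F alpha)).

Definition resolvent_invariant (P : set (C -> 'cV[C]_p)) : Prop :=
  forall alpha, Omega alpha -> forall F, P F -> P (resolvent alpha F).

Definition reproducing_kernel (P : set (C -> 'cV[C]_p))
    (ip : (C -> 'cV[C]_p) -> (C -> 'cV[C]_p) -> C)
    (K : C -> C -> 'M[C]_p) : Prop :=
  forall w, Omega w -> forall xi : 'cV[C]_p,
    P (on_domain (fun z => K z w *m xi)) /\
    (forall F, P F ->
       ip F (on_domain (fun z => K z w *m xi)) = (xi ^t* *m F w) 0 0).

Definition analytic_rk_pontryagin_space (P : set (C -> 'cV[C]_p))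
    (ip : (C -> 'cV[C]_p) -> (C -> 'cV[C]_p) -> C)
    (K : C -> C -> 'M[C]_p) : Prop :=
  [/\ forall F, P F -> on_domain F = F /\ analytic_in F,
      pontryagin_space P ip &
      reproducing_kernel P ip K].

Definition nevanlinna_quotient (N : C -> 'M[C]_p) (z w : C) : 'M[C]_p :=
  (z - w^*)^-1 *: (N z - (N w) ^t*).

(* K = K_N on Omega x Omega; at z = w^* the value is the limit of the
   quotient as its first variable tends to z. *)
Definition is_nevanlinna_kernel (N : C -> 'M[C]_p)
    (K : C -> C -> 'M[C]_p) : Prop :=
  forall z w, Omega z -> Omega w ->
    (z != w^* -> K z w = nevanlinna_quotient N z w) /\
    (z = w^* -> nevanlinna_quotient N x w @[x --> z^'] --> K z w).

End FunctionSpaces.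

(* Main.v *)
Require Import Defs.
From mathcomp Require Import all_boot all_order all_algebra.
From mathcomp Require Import all_classical all_reals all_analysis.
Import GRing.Theory Num.Theory numFieldNormedType.Exports.
Local Open Scope classical_set_scope.
Local Open Scope ring_scope.
Local Open Scope sesquilinear_scope.

(** Write H(z, w) = (z - conj w) K(z, w). In the identity for resolvents take
    beta = conj alpha: the factor in front of the third term vanishes. For two
    kernel sections F = K(., w) xi and G = K(., v) eta, the two remaining terms
    are point evaluations of resolvents, by the reproducing property, and what
    is left is an additive relation ([weighted_kernel_additive]):
      H(v, w) = H(v, conj alpha) + H(alpha, w).
    Since K is Hermitian, H(z, w)^* = - H(w, z). These two facts alone force
    H(v, w) = N(v) - N(w)^* for
      N(z) = H(z, conj alpha) + H(alpha, alpha) / 2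
    ([additive_skew_splits]), where alpha is any base point of Omega. Up to a
    scalar factor z - alpha and a constant, N is one section of the kernel,
    hence it is analytic. Where z = conj w, the kernel K(z, w) is the limit of
    the quotient because the sections of K are continuous. *)

Lemma adjointmxD (C : numClosedFieldType) m n (A B : 'M[C]_(m, n)) :
  (A + B)^t* = A^t* + B^t*.
Proof. by apply/matrixP => i j; rewrite !mxE rmorphD. Qed.

Lemma adjointmxZ (C : numClosedFieldType) m n (c : C) (A : 'M[C]_(m, n)) :
  (c *: A)^t* = c^* *: A^t*.
Proof. by apply/matrixP => i j; rewrite !mxE rmorphM. Qed.

(** With M(z) = H(z, conj a), additivity and skewness give
    H(z, w) = M(z) - M(w)^* + H(a, a). The constant H(a, a) is skew-Hermitian,
    so it is B - B^* for B = H(a, a) / 2, and N = M + B. *)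
Lemma additive_skew_splits (C : numClosedFieldType) (p : nat) (Omega : set C)
    (H : C -> C -> 'M[C]_p) (a : C) :
  conj_symmetric Omega -> Omega a ->
  (forall z w, Omega z -> Omega w -> (H z w)^t* = - H w z) ->
  (forall b z w, Omega b -> Omega z -> Omega w ->
     H z w = H z b^* + H b w) ->
  let N := fun z => H z a^* + 2^-1 *: H a a in
  forall z w, Omega z -> Omega w -> H z w = N z - (N w)^t*.
Proof.
move=> Osym Oa Hskew Hadd N z w Oz Ow; rewrite /N.
have half_real : (2^-1 : C)^* = 2^-1 by rewrite fmorphV rmorph_nat.
have -> : (H w a^* + 2^-1 *: H a a)^t* = - H a^* w - 2^-1 *: H a a.
  rewrite adjointmxD adjointmxZ half_real !Hskew ?scalerN //.
  exact: Osym.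
rewrite (Hadd a z w) // opprD !opprK addrACA -scalerDl.
rewrite -[2^-1]mul1r -splitr scale1r -addrA; congr (_ + _).
by rewrite (Hadd a^* a w) ?conjCK 1?addrC //; exact: Osym.
Qed.

(** The matrix norm is the maximum of the norms of the entries, so it is
    controlled by finitely many scalar conditions. *)
Lemma cvg_mx_entries (K : numFieldType) (T : Type) (m n : nat)
    (F : set_system T) (FF : Filter F) (f : T -> 'M[K]_(m, n))
    (l : 'M[K]_(m, n)) :
  (forall i j, f x i j @[x --> F] --> l i j) -> f x @[x --> F] --> l.
Proof.
move=> fl; apply/cvg_ballP => e e0.
have near_entries :
    \forall x \near F, forall i j, ball (l i j) e (f x i j).
  apply: filter_forall => i; apply: filter_forall => j.
  by move/cvg_ballP: (fl i j) => /(_ e e0).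
by apply: filterS near_entries => x fx; split.
Qed.

Lemma derivable_entriesP (K : numFieldType) (m n : nat)
    (f : K -> 'M[K]_(m, n)) (z v : K) :
  derivable f z v <-> forall i j, derivable (fun x => f x i j) z v.
Proof.
split=> [/cvg_ex[/= l fl] i j|df]; apply/cvg_ex => /=.
  exists (l i j).
  have := cvg_comp _ _ fl (@coord_continuous _ _ _ i j l).
  apply: cvg_trans; apply: near_eq_cvg; apply: nearW => h /=.
  by rewrite !mxE.
exists (\matrix_(i, j)
  lim ((fun h : K => h^-1 *: (f (h *: v + z) i j - f z i j)) @ 0^')).
apply: cvg_mx_entries => i j; rewrite mxE.
under eq_fun do rewrite !mxE.
exact: df.
Qed.

Lemma on_domainE (C : numClosedFieldType) (p : nat) (Omega : set C)
    (F : C -> 'cV[C]_p) (z : C) : Omega z -> on_domain Omega F z = F z.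
Proof. by move=> Oz; rewrite /on_domain patchT ?inE. Qed.

Section ReproducingKernel.
Variables (C : numClosedFieldType) (p : nat) (Omega : set C).
Variables (P : set (C -> 'cV[C]_p)).
Variables (ip : (C -> 'cV[C]_p) -> (C -> 'cV[C]_p) -> C).
Variable K : C -> C -> 'M[C]_p.

Definition kernel_section (w : C) (j : 'I_p) : C -> 'cV[C]_p :=
  on_domain Omega (fun z => K z w *m delta_mx j 0).

Definition weighted_kernel (z w : C) : 'M[C]_p := (z - w^*) *: K z w.

Lemma kernel_sectionE w j z i :
  Omega z -> kernel_section w j z i 0 = K z w i j.
Proof. by move=> Oz; rewrite /kernel_section on_domainE // -colE mxE. Qed.

Hypothesis K_rk : reproducing_kernel Omega P ip K.

Lemma kernel_section_in w j : Omega w -> P (kernel_section w j).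
Proof. by move=> Ow; have [] := K_rk w Ow (delta_mx j 0). Qed.

Lemma ip_kernel_section F w j :
  Omega w -> P F -> ip F (kernel_section w j) = F w j 0.
Proof.
move=> Ow PF; have [_ /(_ F PF) ->] := K_rk w Ow (delta_mx j 0).
by rewrite trmx_delta map_delta_mx -rowE mxE.
Qed.

Hypothesis ip_herm : hermitian_form P ip.

Lemma kernel_hermitian z w : Omega z -> Omega w -> (K z w)^t* = K w z.
Proof.
move=> Oz Ow; apply/matrixP => i j; rewrite !mxE.
have Pz := kernel_section_in z j Oz; have Pw := kernel_section_in w i Ow.
rewrite -(kernel_sectionE z j w i) // -(kernel_sectionE w i z j) //.
rewrite -!ip_kernel_section //.
by rewrite [RHS](ip_herm.2 _ _ _ _) ?inE.
Qed.

Lemma weighted_kernel_skew z w :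
  Omega z -> Omega w -> (weighted_kernel z w)^t* = - weighted_kernel w z.
Proof.
move=> Oz Ow; rewrite /weighted_kernel adjointmxZ kernel_hermitian //.
by rewrite rmorphB /= conjCK -scaleNr opprB.
Qed.

Hypothesis P_inv : resolvent_invariant Omega P.
Hypothesis Omega_sym : conj_symmetric Omega.
Hypothesis P_identity : forall alpha beta, Omega alpha -> Omega beta ->
  forall F G, P F -> P G ->
    ip F (resolvent Omega beta G) - ip (resolvent Omega alpha F) G
      + (alpha - beta^*) *
        ip (resolvent Omega alpha F) (resolvent Omega beta G) = 0.

Lemma resolventE (alpha z : C) (F : C -> 'cV[C]_p) i :
  Omega z -> z != alpha ->
  resolvent Omega alpha F z i 0 = (z - alpha)^-1 * (F z i 0 - F alpha i 0).
Proof. by move=> Oz za; rewrite /resolvent on_domainE // (negPf za) !mxE. Qed.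

(** With beta = alpha^* the term with both resolvents has coefficient 0; the
    other two are values of resolvents of kernel sections. *)
Lemma weighted_kernel_additive a v w : Omega a -> Omega v -> Omega w ->
  weighted_kernel v w = weighted_kernel v a^* + weighted_kernel a w.
Proof.
move=> Oa Ov Ow; have Oac := Omega_sym _ Oa; rewrite /weighted_kernel conjCK.
(* The resolvents are difference quotients only away from these two cases, in
   which both sides coincide anyway. *)
have [->|va] := eqVneq v a; first by rewrite subrr scale0r add0r.
have [->|wa] := eqVneq w a^*; first by rewrite conjCK subrr scale0r addr0.
apply/matrixP => i j; rewrite !mxE.
have PF := kernel_section_in w j Ow; have PG := kernel_section_in v i Ov.
have RF := P_inv _ Oa _ PF; have RG := P_inv _ Oac _ PG.
have := P_identity _ _ Oa Oac _ _ PF PG; rewrite conjCK subrr mul0r addr0.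
move/subr0_eq.
rewrite (ip_herm.2 _ _ _ _) ?inE // !ip_kernel_section //.
rewrite !resolventE // !kernel_sectionE //.
rewrite rmorphM fmorphV !rmorphB /= conjCK.
have herm x y k l : Omega x -> Omega y -> (K x y k l)^* = K y x l k.
  by move=> Ox Oy; rewrite -(kernel_hermitian x y Ox Oy) !mxE.
rewrite !herm //.
have va0 : v - a != 0 by rewrite subr_eq0.
have wa0 : w^* - a != 0 by rewrite subr_eq0 (can2_eq conjCK conjCK).
move=> /(congr1 (fun x => (v - a) * ((w^* - a) * x))).
rewrite mulVKf // [in RHS]mulrCA mulVKf // => E.
have -> : v - w^* = (v - a) - (w^* - a) by rewrite opprB addrA subrK.
rewrite -[a - w^*]opprB mulrBl mulNr.
move: E; rewrite !mulrBr => /(canRL (subrK _)) ->.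
by rewrite [LHS]addrC !addrA addNr add0r addrC.
Qed.

Hypothesis Omega_open : open Omega.
Hypothesis P_analytic : forall F, P F -> analytic_in Omega F.

Lemma kernel_analytic w : Omega w -> analytic_in Omega (fun z => K z w).
Proof.
move=> Ow z Oz; apply/derivable_entriesP => i j.
have /derivable_entriesP/(_ i 0) :=
  P_analytic _ (kernel_section_in w j Ow) z Oz.
apply: near_eq_derivable.
apply: filterS (open_nbhs_nbhs (conj Omega_open Oz)) => x Ox.
exact: kernel_sectionE.
Qed.

Lemma weighted_kernel_analytic w :
  Omega w -> analytic_in Omega (fun z => weighted_kernel z w).
Proof.
move=> Ow z Oz; apply/derivable_entriesP => i j.
rewrite /weighted_kernel; under eq_fun do rewrite mxE.
apply: derivableM; first exact: derivableB.
by have /derivable_entriesP := kernel_analytic w Ow z Oz; exact.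
Qed.

(** For z = conj w the quotient agrees with K(., w) on a punctured neighbourhood
    of z, and K(., w) is continuous at z. *)
Lemma nevanlinna_kernel_of_split (N : C -> 'M[C]_p) :
  (forall z w, Omega z -> Omega w -> weighted_kernel z w = N z - (N w)^t*) ->
  is_nevanlinna_kernel Omega N K.
Proof.
move=> split_K z w Oz Ow.
have quotientE x : Omega x -> x != w^* -> K x w = nevanlinna_quotient N x w.
  move=> Ox xw; rewrite /nevanlinna_quotient -split_K // /weighted_kernel.
  by rewrite scalerA mulVf ?scale1r // subr_eq0.
split=> [zw|zw]; first exact: quotientE.
have cont : K x w @[x --> z^'] --> K z w.
  apply: cvg_within_filter; apply: differentiable_continuous.
  by apply/derivable1_diffP; exact: kernel_analytic.
apply: cvg_trans cont; apply: near_eq_cvg.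
have := open_nbhs_nbhs (conj Omega_open Oz); apply: filterS => x Ox xz.
by rewrite -quotientE // -zw.
Qed.

End ReproducingKernel.

Theorem theorem11p2 (R : realType) (p : nat)
    (Omega : set (complexes R))
    (P : set (complexes R -> 'cV[complexes R]_p))
    (ip : (complexes R -> 'cV[complexes R]_p) ->
          (complexes R -> 'cV[complexes R]_p) -> complexes R)
    (K : complexes R -> complexes R -> 'M[complexes R]_p)
    (Omega_open : open Omega)
    (Omega_sym : conj_symmetric Omega)
    (P_rkps : analytic_rk_pontryagin_space Omega P ip K)
    (P_inv : resolvent_invariant Omega P)
    (P_identity : forall alpha beta, Omega alpha -> Omega beta ->
       forall F G, P F -> P G ->
         ip F (resolvent Omega beta G) - ip (resolvent Omega alpha F) G
           + (alpha - beta^*) *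
             ip (resolvent Omega alpha F) (resolvent Omega beta G) = 0) :
  exists N : complexes R -> 'M[complexes R]_p,
    analytic_in Omega N /\ is_nevanlinna_kernel Omega N K.
Proof.
have [P_an [_ ip_herm _] K_rk] := P_rkps.
have P_analytic F : P F -> analytic_in Omega F by move=> /P_an[].
have [-> | /set0P[a Oa]] := eqVneq Omega set0.
  by exists (fun=> 0); split.
pose H := weighted_kernel _ _ K.
exists (fun z => H z a^* + 2^-1 *: H a a); split.
  move=> z Oz; apply: derivableD; last exact: derivable_cst.
  exact: (weighted_kernel_analytic _ _ _ _ _ _ K_rk) (Omega_sym _ Oa) z Oz.
apply: (nevanlinna_kernel_of_split _ _ _ _ _ _ K_rk) => //.
apply: additive_skew_splits => //.
- move=> z w; exact: (weighted_kernel_skew _ _ _ _ _ _ K_rk ip_herm).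
- move=> b z w.
  exact: (weighted_kernel_additive _ _ _ _ _ _ K_rk ip_herm P_inv).
Qed.
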